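(* There exist constants $c_1$ and $c_2$ such that for all positive integers $m$: (i) $q(m,2,1)\le c_1 m^{1/2}$; (ii) $q(m,2,0)\le c_2 m^{2/3}$.
   Context: For positive integers $m,k$ and an integer $d\ge 0$, $q(m,k,d)$ is the maximum $q$ such that for every set $M$ with $|M|=m$ and every mapping $f:\binom{M}{k}\to\binom{M}{k}$ with $|X\cap f(X)|\le d$ for all $X\in\binom{M}{k}$, there is a subset $Q\subset M$ with $|Q|=q$ such that $f(X)\not\subset Q$ for every $X\in\binom{Q}{k}$. Here $\binom{M}{k}$ denotes the family of $k$-element subsets of $M$. *)

(* Defs.v *)
From mathcomp Require Import all_boot all_order all_algebra.
From mathcomp Require Import boolp reals exp.

Set Implicit Arguments.
Unset Strict Implicit.
Unset Printing Implicit Defensive.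

Definition ksubset (M : finType) (k : nat) := {X : {set M} | #|X| == k}.

Definition almost_disjoint (M : finType) (k d : nat)
    (f : ksubset M k -> ksubset M k) : Prop :=
  forall X : ksubset M k, #|val X :&: val (f X)| <= d.

Definition free_subset (M : finType) (k : nat)
    (f : ksubset M k -> ksubset M k) (Q : {set M}) : Prop :=
  forall X : ksubset M k, val X \subset Q -> ~~ (val (f X) \subset Q).

Definition admissible (m k d q : nat) : Prop :=
  forall (M : finType) (f : ksubset M k -> ksubset M k),
    #|M| = m -> almost_disjoint d f ->
    exists Q : {set M}, #|Q| = q /\ free_subset f Q.

(* A subset of M has at most m elements, so the maximum ranges over q <= m.   *)
(* The bound only has an effect when no map f satisfies the intersection      *)
(* condition (e.g. k = 2, d = 0 and m = 2 or 3): then every q is admissible,  *)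
(* there is no maximum in the naive sense, and qnum m k d = m.                *)
Definition qnum (m k d : nat) : nat :=
  \max_(q < m.+1 | `[< admissible m k d q >]) q.

Lemma qnum_admissible (m k d : nat) : 0 < k -> admissible m k d (qnum m k d).
Proof.
move=> k_gt0; rewrite /qnum.
elim/big_ind: _ => [M f _ _|x y ax ay|q /asboolP //].
- exists set0; split; first exact: cards0.
  move=> X; rewrite subset0 => /eqP X0.
  by have := valP X; rewrite X0 cards0 => /eqP k0; rewrite -k0 in k_gt0.
- by case: (leqP x y) => _.
Qed.

Lemma qnum_max (m k d q : nat) (M : finType) (f : ksubset M k -> ksubset M k) :
  #|M| = m -> almost_disjoint d f -> admissible m k d q -> q <= qnum m k d.
Proof.
move=> Mm fd adm; have [Q [Qq _]] := adm M f Mm fd.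
have q_le : q < m.+1 by rewrite ltnS -Qq -Mm max_card.
by apply: (bigmax_sup (Ordinal q_le)) => //; apply/asboolP.
Qed.

(* Main.v *)
Require Import Defs.
From mathcomp Require Import all_boot all_order all_algebra.
From mathcomp Require Import boolp reals exp.
From mathcomp Require Import zify lra.
Import Order.TTheory GRing.Theory Num.Theory.
Local Open Scope ring_scope.

Set Implicit Arguments.
Unset Strict Implicit.
Unset Printing Implicit Defensive.

(** (i) Place the points in a [q] x [q] grid with [q] about [m^(1/2)], and send
    two points [x], [y] in general position, [x] to the left of [y], to [x] and
    the corner [z] in the column of [x] and the row of [y].  A set [Q] of more
    than [2 q] points contains such a corner: discard the last point of [Q] in
    each row, and take two remaining points of the same column.

    (ii) Place the points in a [q] x [q] x [q] cube with [q] about [m^(1/3)],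
    and send [x = (a, b, c)] and [y = (a', b', c')] with [a < a'] to the two
    inner points [(a, b, c')] and [(a, b', c')] of the axis-parallel path from
    [x] to [y].  As before, a set of more than [3 q^2] points contains a whole
    path: [q^2] lines in each of the three directions cost [q^2] points each. *)

Section Lines.
Variables (M T : finType) (p : M -> T) (c : M -> nat).
Local Open Scope nat_scope.

(* [p] names the line through a point and [c] is the position on that line. *)
Definition nonlast (A : {set M}) : {set M} :=
  [set z in A | [exists w in A, (p w == p z) && (c z < c w)]].

Lemma nonlastP (A : {set M}) z :
  reflect (z \in A /\ exists w, [/\ w \in A, p w = p z & c z < c w])
          (z \in nonlast A).
Proof.
rewrite inE; apply: (iffP andP) => -[zA].
  by case/exists_inP=> w wA /andP[/eqP pw cw]; split=> //; exists w.
case=> w [wA pw cw]; split=> //; apply/exists_inP; exists w => //.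
by rewrite pw eqxx.
Qed.

Hypothesis pc_inj : forall z w, p z = p w -> c z = c w -> z = w.

(** Each line loses at most one point, its last one in [A], because [c] separates the points of a
    line. *)
Lemma card_nonlast (A : {set M}) (n : nat) :
  n + #|T| < #|A| -> n < #|nonlast A|.
Proof.
move=> /leq_trans h; rewrite -(ltn_add2r #|T|); apply: h.
rewrite -(cardsID (nonlast A) A).
have /setIidPr -> : nonlast A \subset A by apply/subsetP => z /nonlastP[].
rewrite leq_add2l -(@card_in_imset _ _ p) ?max_card //.
move=> z w /setDP[zA zN] /setDP[wA wN] pzw; apply: pc_inj => //.
case: (ltngtP (c z) (c w)) => // h.
  by case/nonlastP: zN; split=> //; exists w.
by case/nonlastP: wN; split=> //; exists z.
Qed.

End Lines.

(** A coordinate recovers the order of an unordered pair, so a rule stated for ordered points is a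
    function of the pair. *)
Lemma ordered_pair_inj (M : finType) (c : M -> nat) (x y x' y' : M) :
  [set x; y] = [set x'; y'] -> (c x < c y)%N -> (c x' < c y')%N ->
  x = x' /\ y = y'.
Proof.
move=> E xy xy'.
have := set21 x y; have := set22 x y; rewrite E.
move=> /set2P[] ey /set2P[] ex; subst; try lia.
by split.
Qed.

Lemma exists_disjoint_pair (M : finType) (X : {set M}) :
  (#|X| + 2 <= #|M|)%N -> exists Y : {set M}, #|Y| = 2 /\ X :&: Y = set0.
Proof.
move=> h; have : (1 < #|~: X|)%N by have := cardsC X; lia.
case/card_gt1P=> y [z [yX zX yz]]; exists [set y; z]; rewrite cards2 yz.
split=> //; apply/eqP; rewrite setI_eq0 disjoints_subset.
apply/subsetP => u uX; rewrite inE; apply/negP.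
by move=> /set2P[] e; subst; move: yX zX; rewrite !inE uX.
Qed.

(* A partial map on pairs suffices: it extends by disjoint pairs. *)
Lemma qnum_le_of_partial_map (m d b : nat)
    (P : {set 'I_m} -> {set 'I_m} -> Prop) :
  (3 < m)%N ->
  (forall X Y Z, P X Y -> P X Z -> Y = Z) ->
  (forall X Y, P X Y -> #|Y| = 2 /\ (#|X :&: Y| <= d)%N) ->
  (forall Q : {set 'I_m}, (b < #|Q|)%N ->
     exists X Y : {set 'I_m}, [/\ #|X| = 2, X \subset Q, Y \subset Q & P X Y]) ->
  (qnum m 2 d <= b)%N.
Proof.
move=> m_gt3 Pfun Psize Phit.
have /choice[f fP] : forall X : ksubset 'I_m 2, exists Y : ksubset 'I_m 2,
    (#|val X :&: val Y| <= d)%N /\ forall Z, P (val X) Z -> Z = val Y.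
  move=> X; case: (pselect (exists Y, P (val X) Y)) => [[Y XY]|nXY].
    have [/eqP Y2 Yd] := Psize _ _ XY.
    by exists (exist _ Y Y2); split=> // Z XZ; apply: Pfun XZ XY.
  (* Default value off the domain of [P]: since [3 < m], two points remain outside [X]. *)
  have [|Y [/eqP Y2 XY0]] := @exists_disjoint_pair 'I_m (val X).
    by rewrite (eqP (valP X)) card_ord.
  exists (exist _ Y Y2); split; first by rewrite /= XY0 cards0.
  by move=> Z XZ; case: nXY; exists Z.
have [//|||Q [Qq Qfree]] := @qnum_admissible m 2 d _ 'I_m f.
- exact: card_ord.
- by move=> X; case: (fP X).
(* With more than [b] points, [Q] would contain some [X] and its image, against freeness. *)
rewrite leqNgt -Qq; apply/negP => /Phit[X [Y [/eqP X2 XQ YQ XY]]].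
have := Qfree (exist _ X X2) XQ.
by have [_ /(_ _ XY) <-] := fP (exist _ X X2); rewrite YQ.
Qed.

Lemma qnum_le (m k d : nat) : (qnum m k d <= m)%N.
Proof. by apply/bigmax_leqP => q _; rewrite -ltnS. Qed.

Lemma exists_injection_ord (T : finType) (m : nat) :
  (m <= #|T|)%N -> exists e : 'I_m -> T, injective e.
Proof.
move=> h; exists (fun i => enum_val (widen_ord h i)).
by move=> i j /enum_val_inj/(congr1 val)/= /val_inj.
Qed.

Lemma qnum21_le (m q : nat) :
  (3 < m)%N -> (m <= q ^ 2)%N -> (qnum m 2 1 <= 2 * q)%N.
Proof.
move=> m_gt3 mq.
have [|e e_inj] := @exists_injection_ord ('I_q * 'I_q)%type m.
  by rewrite card_prod !card_ord mulnn.
pose col z := (e z).1; pose row z := (e z).2.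
have cr_inj z w : col z = col w -> row z = row w -> z = w.
  rewrite /col /row => h1 h2; apply: e_inj.
  by case: (e z) (e w) h1 h2 => [? ?] [? ?] /= -> ->.
(* Only pairs of one orientation are sent to a corner; it is the one that the pruning below
   produces. *)
pose P (X Y : {set 'I_m}) := exists x y z,
  [/\ X = [set x; y], (col x < col y)%N, (row y < row x)%N,
      col z = col x /\ row z = row y & Y = [set x; z]].
apply: (@qnum_le_of_partial_map m 1 (2 * q) P) => //.
- move=> X Y Z [x [y [z [Xe cxy _ [zc zr] ->]]]].
  move=> [x' [y' [z' [Xe' cxy' _ [zc' zr'] ->]]]]; subst X.
  have [ex ey] := ordered_pair_inj (c := fun t => col t) Xe' cxy cxy'; subst.
  by rewrite (@cr_inj z z') // ?zc ?zr.
- move=> X Y [x [y [z [-> cxy ryx [zc zr] ->]]]].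
  have xz : x != z by apply/eqP => h; subst; rewrite zr ltnn in ryx.
  have yz : y != z by apply/eqP => h; subst; rewrite zc ltnn in cxy.
  have yx : y != x by apply/eqP => h; subst; rewrite ltnn in cxy.
  rewrite cards2 xz; split=> //; rewrite -(cards1 x); apply: subset_leq_card.
  apply/subsetP => u; rewrite !inE => /andP[/orP[/eqP->|/eqP->]] //.
  by rewrite (negPf yx) (negPf yz).
- move=> Q Qbig.
  (* A point of [B] has some [y] of [Q] further along its row; a point [z] of [D] also has some [x]
     of [B] further along its column. So [z] is the corner of [x] and [y]. *)
  pose B := nonlast row (fun t => col t : nat) Q.
  pose D := nonlast col (fun t => row t : nat) B.
  have inj1 z w : row z = row w -> col z = col w :> nat -> z = w.
    by move=> h /val_inj h'; apply: cr_inj.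
  have inj2 z w : col z = col w -> row z = row w :> nat -> z = w.
    by move=> h /val_inj h'; apply: cr_inj.
  have : (0 < #|D|)%N.
    by do 2!apply: card_nonlast => //; rewrite card_ord add0n addnn -mul2n.
  case/card_gt0P => z /nonlastP[/nonlastP[zQ [y [yQ ry cy]]]].
  case=> x [/nonlastP[xQ _] cx rx].
  exists [set x; y], [set x; z]; split.
  + by rewrite cards2; case: eqP => // h; subst; rewrite cx ltnn in cy.
  + by apply/subsetP => u /set2P[]->.
  + by apply/subsetP => u /set2P[]->.
  + by exists x, y, z; rewrite cx ry.
Qed.

Lemma qnum20_le (m q : nat) :
  (3 < m)%N -> (m <= q ^ 3)%N -> (qnum m 2 0 <= 3 * q ^ 2)%N.
Proof.
move=> m_gt3 mq.
have [|e e_inj] := @exists_injection_ord ('I_q * 'I_q * 'I_q)%type m.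
  by rewrite !card_prod !card_ord mulnn -expnSr.
pose a z := (e z).1.1; pose b z := (e z).1.2; pose c z := (e z).2.
have abc_inj z w : a z = a w -> b z = b w -> c z = c w -> z = w.
  rewrite /a /b /c => h1 h2 h3; apply: e_inj.
  by case: (e z) (e w) h1 h2 h3 => [[? ?] ?] [[? ?] ?] /= -> -> ->.
(* The path [x], [z], [w], [y] changes [c], then [b], then [a]; strict inequalities make the two
   pairs disjoint. *)
pose P (X Y : {set 'I_m}) := exists x y z w,
  [/\ X = [set x; y], [/\ (a x < a y)%N, (b x < b y)%N & (c y < c x)%N],
      [/\ a z = a x, b z = b x & c z = c y],
      [/\ a w = a x, b w = b y & c w = c y] & Y = [set z; w]].
apply: (@qnum_le_of_partial_map m 0 (3 * q ^ 2) P) => //.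
- move=> X Y Z [x [y [z [w [Xe [axy _ _] [z1 z2 z3] [w1 w2 w3] ->]]]]].
  move=> [x' [y' [z' [w' [Xe' [axy' _ _] [z1' z2' z3'] [w1' w2' w3'] ->]]]]].
  subst X.
  have [ex ey] := ordered_pair_inj (c := fun t => a t) Xe' axy axy'; subst.
  rewrite (@abc_inj z z') ?z1 ?z2 ?z3 //.
  by rewrite (@abc_inj w w') ?w1 ?w2 ?w3.
- move=> X Y [x [y [z [w [-> [axy bxy cyx] [z1 z2 z3] [w1 w2 w3] ->]]]]].
  have zw : z != w by apply/eqP => h; subst; rewrite -w2 z2 ltnn in bxy.
  have xz : x != z by apply/eqP => h; subst; rewrite z3 ltnn in cyx.
  have xw : x != w by apply/eqP => h; subst; rewrite w3 ltnn in cyx.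
  have yz : y != z by apply/eqP => h; subst; rewrite z1 ltnn in axy.
  have yw : y != w by apply/eqP => h; subst; rewrite w1 ltnn in axy.
  rewrite cards2 zw; split=> //; rewrite leqn0 cards_eq0 -subset0.
  apply/subsetP => u; rewrite !inE => /andP[/orP[/eqP->|/eqP->]].
    by rewrite (negPf xz) (negPf xw).
  by rewrite (negPf yz) (negPf yw).
- move=> Q Qbig.
  (* From [z] in [E], go along [c] to [x] and along [b] to [w] in [D]. Pruning along [b] comes last,
     so [w] is still in [B] and has its [y] along [a]. *)
  pose B := nonlast (fun t => (b t, c t)) (fun t => a t : nat) Q.
  pose D := nonlast (fun t => (a t, b t)) (fun t => c t : nat) B.
  pose E := nonlast (fun t => (a t, c t)) (fun t => b t : nat) D.
  have inj1 z w : (b z, c z) = (b w, c w) -> a z = a w :> nat -> z = w.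
    by case=> ? ? /val_inj ?; apply: abc_inj.
  have inj2 z w : (a z, b z) = (a w, b w) -> c z = c w :> nat -> z = w.
    by case=> ? ? /val_inj ?; apply: abc_inj.
  have inj3 z w : (a z, c z) = (a w, c w) -> b z = b w :> nat -> z = w.
    by case=> ? ? /val_inj ?; apply: abc_inj.
  have : (0 < #|E|)%N.
    do 3!apply: card_nonlast => //.
    by rewrite card_prod !card_ord mulnn add0n addnn -mul2n -mulSnr.
  case/card_gt0P => z /nonlastP[/nonlastP[/nonlastP[zQ _]]].
  case=> x [/nonlastP[xQ _] [ax bx] cx].
  case=> w [/nonlastP[/nonlastP[wQ [y [yQ [by_ cy] ay]]] _] [aw cw] bw].
  exists [set x; y], [set z; w]; split.
  + rewrite cards2; case: eqP => // h; subst.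
    by rewrite aw -ax ltnn in ay.
  + by apply/subsetP => u /set2P[]->.
  + by apply/subsetP => u /set2P[]->.
  + by exists x, y, z, w; rewrite ax bx cy by_ cw -aw.
Qed.

Lemma powR_natr_ge1 (R : realType) (m : nat) (s : R) :
  (0 < m)%N -> 0 <= s -> 1 <= m%:R `^ s.
Proof.
move=> m_gt0 s_ge0; rewrite [leLHS](_ : _ = 1 `^ s); last by rewrite powR1.
by rewrite ge0_ler_powR ?nnegrE // ler1n.
Qed.

(** Round the root [r] down and add one: [r >= 1] gives [q <= r + 1 <= 2 r]. *)
Lemma exists_nat_root (R : realType) (m k : nat) : (0 < m)%N -> (0 < k)%N ->
  exists q : nat, (m <= q ^ k)%N /\ q%:R <= 2 * m%:R `^ (1 / k%:R) :> R.
Proof.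
move=> m_gt0 k_gt0; set r : R := m%:R `^ (1 / k%:R).
have r_ge1 : 1 <= r by rewrite powR_natr_ge1 ?divr_ge0.
have rk : r ^+ k = m%:R.
  rewrite -powR_mulrn ?powR_ge0 // -powRrM mul1r mulVf ?powRr1 //.
  by rewrite pnatr_eq0 -lt0n.
have r_ge0 : 0 <= r by lra.
have /andP[q1 q2] := truncn_itv r_ge0.
exists (Num.truncn r).+1; split.
  by rewrite -(ler_nat R) natrX -rk lerXn2r ?nnegrE // ltW.
by rewrite -natr1; lra.
Qed.

Theorem theorem2p2 (R : realType) :
  exists c1 c2 : R, forall m : nat, (0 < m)%N ->
    (qnum m 2 1)%:R <= c1 * m%:R `^ (1 / 2) /\
    (qnum m 2 0)%:R <= c2 * m%:R `^ (2 / 3).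
Proof.
(* With [q] at most twice the root [r], [2 q <= 4 r] and [3 q ^ 2 <= 12 r ^ 2]. *)
exists 4, 12 => m m_gt0.
have p12 : 1 <= m%:R `^ (1 / 2 : R) by rewrite powR_natr_ge1 ?divr_ge0.
have p23 : 1 <= m%:R `^ (2 / 3 : R) by rewrite powR_natr_ge1 ?divr_ge0.
(* For [m <= 3] disjoint pairs do not exist; the trivial bound [3] suffices, as both powers are at
   least 1. *)
have [m_le3|m_gt3] := leqP m 3.
  have small d : (qnum m 2 d)%:R <= 3 :> R.
    by rewrite ler_nat (leq_trans (qnum_le _ _ _)).
  by have := small 0; have := small 1; split; lra.
split.
  have [q [mq qr]] := @exists_nat_root R m 2 m_gt0 isT.
  have := qnum21_le m_gt3 mq; rewrite -(ler_nat R) natrM; lra.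
have [q [mq qr]] := @exists_nat_root R m 3 m_gt0 isT.
have -> : m%:R `^ (2 / 3) = (m%:R `^ (1 / 3)) ^+ 2 :> R.
  by rewrite -powR_mulrn ?powR_ge0 // -powRrM; congr (_ `^ _); lra.
have := qnum20_le m_gt3 mq; rewrite -(ler_nat R) natrM natrX.
have : (q%:R : R) ^+ 2 <= (2 * m%:R `^ (1 / 3)) ^+ 2.
  by rewrite lerXn2r ?nnegrE // mulr_ge0 ?powR_ge0.
rewrite exprMn; lra.
Qed.
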